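(* Let $(G,P,\theta)$ be an algebraic dynamical system such that $G$ and $P$ are abelian and $[G:\theta_p(G)]<\infty$ for all $p\in P$. If $C^*(G)\subset\mathcal{Q}(G\rtimes_\theta P)$ is maximal abelian and $\mathcal{Q}(G\rtimes_\theta P)$ is simple, then the group ${\rm Aut}_{C^*(G)}\mathcal{Q}(G\rtimes_\theta P)$ is maximal abelian in ${\rm Aut}\,\mathcal{Q}(G\rtimes_\theta P)$.
   Context: An algebraic dynamical system is a triple $(G,P,\theta)$ where $G$ is a countable discrete group; $P$ is a right LCM semigroup, i.e. a countable left cancellative monoid in which the intersection of two principal right ideals is either empty or another principal right ideal; and $\theta$ is an action of $P$ on $G$ by injective group endomorphisms $\theta_p$ which respects the order: $pP\cap qP=rP$ implies $\theta_p(G)\cap\theta_q(G)=\theta_r(G)$. Write $N_p=[G:\theta_p(G)]$. An abelian $P$ is directed with respect to $p\geq q\Leftrightarrow p\in qP$. For directed $P$, the boundary quotient $\mathcal{Q}(G\rtimes_\theta P)$ is the universal $C^*$-algebra generated by a unitary representation $u$ of $G$ and a representation $s$ of the monoid $P$ by isometries satisfying (I) $s_pu_g=u_{\theta_p(g)}s_p$; (II) $s_p^*u_gs_q=u_{g_1}s_{p'}s_{q'}^*u_{g_2}$ if $g=\theta_p(g_1)\theta_q(g_2)$ and $pP\cap qP=pp'P$, $pp'=qq'$, and $s_p^*u_gs_q=0$ otherwise; (III) $\sum_{[g]\in G/\theta_p(G)}u_gs_ps_p^*u_g^*=1$ whenever $N_p<\infty$. $C^*(G)$ is identified with the $C^*$-subalgebra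 of $\mathcal{Q}(G\rtimes_\theta P)$ generated by $\{u_g\mid g\in G\}$. ${\rm Aut}_{C^*(G)}\mathcal{Q}(G\rtimes_\theta P)$ denotes the group of $*$-automorphisms of $\mathcal{Q}(G\rtimes_\theta P)$ that fix $C^*(G)$ pointwise. A subgroup is maximal abelian if it is abelian and not properly contained in another abelian subgroup. *)

(* Defs.v *)
From HB Require Import structures.
From mathcomp Require Import all_boot all_order all_algebra.
From mathcomp Require Import all_classical all_reals.
From mathcomp Require Import topology normedtype.
From mathcomp Require Import complex.

Set Implicit Arguments.
Unset Strict Implicit.
Unset Printing Implicit Defensive.

Import Order.TTheory GRing.Theory Num.Theory.
Import numFieldNormedType.Exports.

Local Open Scope classical_set_scope.
Local Open Scope ring_scope.

Section AlgebraicDynamicalSystems.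

Variables (G : groupType) (P : monoidType).

Definition principal_right_ideal (p : P) : set P := range (fun x => (p * x)%g).

(* the principal right ideals pP and qP meet in rP *)
Definition ideals_meet_in (p q r : P) :=
  principal_right_ideal p `&` principal_right_ideal q = principal_right_ideal r.

Definition left_cancellative := forall p x y : P, (p * x = p * y)%g -> x = y.

Definition right_LCM_semigroup :=
  [/\ countable [set: P], left_cancellative &
      forall p q : P,
        principal_right_ideal p `&` principal_right_ideal q = set0 \/
        exists r, ideals_meet_in p q r].

Record is_injective_action (theta : P -> G -> G) : Prop := {
  act_morph : forall p (g h : G),
    theta p (g * h)%g = (theta p g * theta p h)%g;
  act_inj : forall p, injective (theta p);
  act_one : forall g, theta 1%g g = g;
  act_mul : forall (p q : P) g, theta (p * q)%g g = theta p (theta q g) }.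

Definition respects_order (theta : P -> G -> G) := forall p q r : P,
  ideals_meet_in p q r ->
  range (theta p) `&` range (theta q) = range (theta r).

Definition algebraic_dynamical_system (theta : P -> G -> G) : Prop :=
  [/\ countable [set: G], right_LCM_semigroup,
      is_injective_action theta & respects_order theta].

Definition left_coset (H : set G) (g : G) : set G :=
  (fun h => (g * h)%g) @` H.

Definition finite_index (H : set G) := finite_set (range (left_coset H)).

(* T lists exactly one representative of every left coset of H *)
Definition left_transversal (H : set G) (T : seq G) : Prop :=
  uniq T /\ forall g, exists! t, t \in T /\ left_coset H t = left_coset H g.

End AlgebraicDynamicalSystems.

(* Unital, nonzero complex C*-algebras; the norm is R[i]-valued, as for any
   normedModType over R[i].  MathComp's hierarchy has no join of rings and
   normed modules, so the multiplication is introduced here on top of the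
   Banach space structure and the resulting algType structure is declared
   below. *)
HB.mixin Record isCStarAlgebra (R : realType) A
    of CompleteNormedModule R[i] A := {
  cstar_mul : A -> A -> A;
  cstar_one : A;
  star : A -> A;
  cstar_mulA : associative cstar_mul;
  cstar_mul1 : left_id cstar_one cstar_mul;
  cstar_mulr1 : right_id cstar_one cstar_mul;
  cstar_mulDl : left_distributive cstar_mul +%R;
  cstar_mulDr : right_distributive cstar_mul +%R;
  cstar_one_neq0 : cstar_one != 0;
  cstar_scaleAl : forall (a : R[i]) (x y : A),
    a *: cstar_mul x y = cstar_mul (a *: x) y;
  cstar_scaleAr : forall (a : R[i]) (x y : A),
    a *: cstar_mul x y = cstar_mul x (a *: y);
  starK : involutive star;
  starD : forall x y : A, star (x + y) = star x + star y;
  starZ : forall (a : R[i]) (x : A), star (a *: x) = Num.conj a *: star x;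
  star_cstar_mul : forall x y : A,
    star (cstar_mul x y) = cstar_mul (star y) (star x);
  norm_cstar_mul : forall x y : A, `|cstar_mul x y| <= `|x| * `|y|;
  norm_star_cstar_mul : forall x : A, `|cstar_mul (star x) x| = `|x| ^+ 2 }.

#[short(type="cstarAlgType")]
HB.structure Definition CStarAlgebra (R : realType) :=
  {A of isCStarAlgebra R A & CompleteNormedModule R[i] A}.

Section CStarAlgebraRing.

Variables (R : realType) (A : cstarAlgType R).

#[non_forgetful_inheritance]
HB.instance Definition _ := GRing.Zmodule_isNzRing.Build A
  (@cstar_mulA R A) (@cstar_mul1 R A) (@cstar_mulr1 R A)
  (@cstar_mulDl R A) (@cstar_mulDr R A) (@cstar_one_neq0 R A).

#[non_forgetful_inheritance]
HB.instance Definition _ := GRing.Lmodule_isLalgebra.Build R[i] A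
  (@cstar_scaleAl R A).

#[non_forgetful_inheritance]
HB.instance Definition _ := GRing.Lalgebra_isAlgebra.Build R[i] A
  (@cstar_scaleAr R A).

Lemma starM (x y : A) : star (x * y) = star y * star x.
Proof. exact: star_cstar_mul. Qed.

Lemma norm_submult (x y : A) : `|x * y| <= `|x| * `|y|.
Proof. exact: norm_cstar_mul. Qed.

Lemma norm_star_mul (x : A) : `|star x * x| = `|x| ^+ 2.
Proof. exact: norm_star_cstar_mul. Qed.

Lemma star_one : star 1 = 1 :> A.
Proof. by rewrite -[LHS]mul1r -{1}[1](@starK R A) -starM mul1r starK. Qed.

End CStarAlgebraRing.

Section CStarNotions.

Variables (R : realType).
Implicit Types A B : cstarAlgType R.

Definition is_star_hom A B (f : A -> B) : Prop :=
  [/\ linear f, monoid_morphism f & forall x, f (star x) = star (f x)].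

Record is_cstar_subalgebra A (D : set A) : Prop := {
  csub_0 : D 0;
  csub_D : forall x y, D x -> D y -> D (x + y);
  csub_Z : forall (a : R[i]) x, D x -> D (a *: x);
  csub_M : forall x y, D x -> D y -> D (x * y);
  csub_star : forall x, D x -> D (star x);
  csub_closed : closed D }.

Definition cstar_generated A (S : set A) : set A :=
  smallest (@is_cstar_subalgebra A) S.

Definition commutative_set A (D : set A) : Prop :=
  forall x y, D x -> D y -> x * y = y * x.

Definition maximal_abelian_subalgebra A (D : set A) : Prop :=
  [/\ is_cstar_subalgebra D, commutative_set D &
      forall E : set A, is_cstar_subalgebra E -> commutative_set E ->
        D `<=` E -> E = D].

Record is_closed_ideal A (I : set A) : Prop := {
  ideal_0 : I 0;
  ideal_D : forall x y, I x -> I y -> I (x + y);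
  ideal_Z : forall (a : R[i]) x, I x -> I (a *: x);
  ideal_Ml : forall a x, I x -> I (a * x);
  ideal_Mr : forall a x, I x -> I (x * a);
  ideal_closed : closed I }.

Definition cstar_simple A : Prop :=
  forall I : set A, is_closed_ideal I -> I = [set 0] \/ I = setT.

Definition star_aut A := {f : A -> A | is_star_hom f /\ bijective f}.

End CStarNotions.

Section AutomorphismGroup.

Variables (R : realType) (A : cstarAlgType R).

HB.instance Definition _ := gen_eqMixin (star_aut A).
HB.instance Definition _ := gen_choiceMixin (star_aut A).

Lemma star_aut_inj (f g : star_aut A) : sval f =1 sval g -> f = g.
Proof.
case: f g => [f hf] [g hg] /= /funext fg; subst g.
by rewrite (Prop_irrelevance hf hg).
Qed.

Lemma star_aut_id_subproof : is_star_hom (@idfun A) /\ bijective (@idfun A).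
Proof. by split; [split | exists idfun]. Qed.

Lemma star_aut_comp_subproof (f g : star_aut A) :
  is_star_hom (sval f \o sval g) /\ bijective (sval f \o sval g).
Proof.
case: f g => [f [[fL [f1 fM] fS] fb]] [g [[gL [g1 gM] gS] gb]] /=.
split; last exact: bij_comp.
split => [a x y||x] /=; first by rewrite gL fL.
- by split => [|x y] /=; rewrite ?g1 ?f1 // gM fM.
- by rewrite gS fS.
Qed.

Lemma star_aut_inv_ex (f : star_aut A) :
  exists g : A -> A, [/\ cancel (sval f) g, cancel g (sval f)
                       & is_star_hom g /\ bijective g].
Proof.
case: f => [f [[fL [f1 fM] fS] [g fK gK]]] /=; exists g; split=> //.
split; last by exists f.
have fI := can_inj fK.
split => [a x y||x]; first by apply: fI; rewrite fL !gK.
- by split => [|x y]; apply: fI; rewrite ?f1 ?fM !gK.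
- by apply: fI; rewrite fS !gK.
Qed.

Definition star_aut_one : star_aut A := exist _ _ star_aut_id_subproof.
Definition star_aut_mul (f g : star_aut A) : star_aut A :=
  exist _ _ (star_aut_comp_subproof f g).
Definition star_aut_inv (f : star_aut A) : star_aut A :=
  let g := cid (star_aut_inv_ex f) in
  exist _ (sval g) (let: And3 _ _ h := svalP g in h).

Lemma star_aut_mulA : associative star_aut_mul.
Proof. by move=> f g h; apply: star_aut_inj. Qed.

Lemma star_aut_mul1 : left_id star_aut_one star_aut_mul.
Proof. by move=> f; apply: star_aut_inj. Qed.

Lemma star_aut_mulr1 : right_id star_aut_one star_aut_mul.
Proof. by move=> f; apply: star_aut_inj. Qed.

Lemma star_aut_mulV : left_inverse star_aut_one star_aut_inv star_aut_mul.
Proof.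
move=> f; apply: star_aut_inj => x /=.
by case: cid => g [/= fK _ _]; exact: fK.
Qed.

Lemma star_aut_mulVr : right_inverse star_aut_one star_aut_inv star_aut_mul.
Proof.
move=> f; apply: star_aut_inj => x /=.
by case: cid => g [/= _ gK _]; exact: gK.
Qed.

HB.instance Definition _ := isGroup.Build (star_aut A)
  star_aut_mulA star_aut_mul1 star_aut_mulr1 star_aut_mulV star_aut_mulVr.

(* Aut_D A, the automorphisms of A that fix D pointwise *)
Definition aut_fixing (D : set A) : set (star_aut A) :=
  [set f | forall x, D x -> sval f x = x].

End AutomorphismGroup.

Section MaximalAbelianSubgroups.

Variable Gamma : groupType.

Definition is_subgroup (H : set Gamma) : Prop :=
  [/\ H 1%g, forall x y, H x -> H y -> H (x * y)%g
    & forall x, H x -> H (x^-1)%g].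

Definition is_abelian_subgroup (H : set Gamma) : Prop :=
  is_subgroup H /\ forall x y, H x -> H y -> (x * y = y * x)%g.

Definition maximal_abelian_subgroup (H : set Gamma) : Prop :=
  is_abelian_subgroup H /\
  forall K : set Gamma, is_abelian_subgroup K -> H `<=` K -> K = H.

End MaximalAbelianSubgroups.

Section BoundaryQuotient.

Variables (R : realType) (G : groupType) (P : monoidType).
Variable theta : P -> G -> G.

Record is_unitary_rep (A : cstarAlgType R) (u : G -> A) : Prop := {
  urep_one : u 1%g = 1;
  urep_mul : forall g h : G, u (g * h)%g = u g * u h;
  urep_starl : forall g, star (u g) * u g = 1;
  urep_starr : forall g, u g * star (u g) = 1 }.

Record is_isometric_rep (A : cstarAlgType R) (s : P -> A) : Prop := {
  irep_one : s 1%g = 1;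
  irep_mul : forall p q : P, s (p * q)%g = s p * s q;
  irep_star : forall p, star (s p) * s p = 1 }.

(* the data occurring in relation (II): g = theta_p(g1) theta_q(g2),
   pP `&` qP = pp'P and pp' = qq' *)
Definition rel_II_data (p q : P) (g g1 g2 : G) (p' q' : P) : Prop :=
  [/\ g = (theta p g1 * theta q g2)%g,
      ideals_meet_in p q (p * p')%g & (p * p' = q * q')%g].

Record boundary_relations (A : cstarAlgType R) (u : G -> A) (s : P -> A)
    : Prop := {
  rel_unitary : is_unitary_rep u;
  rel_isometric : is_isometric_rep s;
  rel_I : forall p g, s p * u g = u (theta p g) * s p;
  rel_II : forall p q g g1 g2 p' q', rel_II_data p q g g1 g2 p' q' ->
    star (s p) * u g * s q = u g1 * s p' * star (s q') * u g2;
  rel_II_zero : forall p q g,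
    ~ (exists g1 g2 p' q', rel_II_data p q g g1 g2 p' q') ->
    star (s p) * u g * s q = 0;
  (* by (I) the summand depends only on the coset of g, so the choice of the
     representatives T is immaterial *)
  rel_III : forall p, finite_index (range (theta p)) ->
    forall T, left_transversal (range (theta p)) T ->
    \sum_(g <- T) u g * s p * star (s p) * star (u g) = 1 }.

(* (A, u, s) is the universal C*-algebra generated by the above relations;
   for abelian P the directedness of P is automatic, since pq lies in both
   pP and qP. *)
Definition is_boundary_quotient (A : cstarAlgType R) (u : G -> A) (s : P -> A)
    : Prop :=
  [/\ boundary_relations u s,
      cstar_generated (range u `|` range s) = setT
    & forall (B : cstarAlgType R) (v : G -> B) (t : P -> B),
        boundary_relations v t ->
        exists! f : A -> B,
          [/\ is_star_hom f, forall g, f (u g) = v g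
            & forall p, f (s p) = t p]].

End BoundaryQuotient.

(* Main.v *)
Require Import Defs.
From mathcomp Require Import all_boot all_order all_algebra.
From mathcomp Require Import all_classical all_reals.
From mathcomp Require Import topology normedtype sequences.
From mathcomp Require Import complex ring lra.

(** Let D be the C*-algebra generated by the unitaries u_g; being maximal
    abelian, it is its own commutant ([masa_commutant]).

    Aut_D is abelian.  If alpha fixes D, then x = alpha(s_p) satisfies the same
    covariance x u_h = u_(theta_p(h)) x as s_p.  Averaging x s_p^* over the
    cosets of theta_p(G) gives an element w of A with w s_p = x that commutes
    with every u_g, hence w lies in D ([intertwiner_factor]).  So each alpha in
    Aut_D multiplies s_p by an element w of D.  As D is commutative and fixed
    by Aut_D, two such automorphisms commute on the generators, and the
    universal property makes them commute on A ([aut_fixing_abelian]).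

    Aut_D is maximal abelian.  This half holds for any maximal abelian
    subalgebra D of a simple C*-algebra whose group Aut_D is abelian
    ([masa_maximal_abelian_aut]).  Let f commute with Aut_D.  For a unitary w
    of D, conjugation by w belongs to Aut_D; commuting with it forces
    w^* f(w) to be central, and a simple algebra has scalar center
    ([simple_center]), so f(w) is a multiple of w.  Applied to the Cayley
    transforms of two small multiples of a self-adjoint h in D, this shows
    that f(h) - h is scalar ([cayley_relation]).  Comparing with f(h^2), the
    scalar vanishes unless h itself is scalar; so f fixes h in all cases, and
    therefore fixes D.

    That the center is scalar is a case of the Gelfand-Mazur theorem.  It is
    obtained without spectral theory, from the C*-identity and from inverses
    and square roots of elements close to 1, both of which are fixed points of
    contractions ([simple_central_sqr], [csub_inverse], [csub_sqrt]). *)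

Set Implicit Arguments.
Unset Strict Implicit.
Unset Printing Implicit Defensive.

Import Order.TTheory GRing.Theory Num.Theory.
Import numFieldNormedType.Exports.

Local Open Scope classical_set_scope.
Local Open Scope ring_scope.

(** * Contractions of complex Banach spaces *)

Section FixedPoints.

Variable R : realType.

Lemma complex_expr_small (r e : R[i]) : 0 <= r -> r < 1 -> 0 < e ->
  exists n, r ^+ n < e.
Proof.
move=> r0 r1 e0.
have rr : r \is Num.real by rewrite ger0_real.
have er : e \is Num.real by rewrite gtr0_real.
rewrite -(RRe_real rr) -(RRe_real er) in r0 r1 e0 *.
set a := complex.Re r in r0 r1 *; set b := complex.Re e in e0 *.
rewrite ler0c in r0; rewrite ltcR in e0.
rewrite -(rmorph1 (real_complex R)) ltcR in r1.
have a1 : `|a| < 1 by rewrite ger0_norm.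
have /cvgrPdist_lt /(_ _ e0) [N _ /(_ N (leqnn _))] := cvg_expr a1.
rewrite /= sub0r normrN ger0_norm ?exprn_ge0 // => h.
by exists N; rewrite -rmorphXn /= ltcR.
Qed.

Lemma norm_closed (V : normedModType R[i]) (S : set V) :
  (forall x, (forall e, 0 < e -> exists2 y, S y & `|x - y| < e) -> S x) ->
  closed S.
Proof.
move=> h x cx; apply: h => e e0.
have [y [Sy xy]] := cx _ (nbhsx_ballx x e e0).
by exists y => //; move: xy; rewrite -ball_normE.
Qed.

Lemma closed_norm_approx (V : normedModType R[i]) (S : set V) x :
  closed S -> (forall e, 0 < e -> exists2 y, S y & `|x - y| < e) -> S x.
Proof.
move=> cS h; apply: cS => B /nbhs_ballP [e /= e0 sB].
have [y Sy xy] := h _ e0; exists y; split=> //; apply: sB.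
by rewrite -ball_normE.
Qed.

(** The contraction principle with constants in R[i]: norms on a complex Banach
    space take their values there. *)
Lemma contraction_fixpoint (V : completeNormedModType R[i]) (S : set V)
    (F : V -> V) (r : R[i]) (y0 : V) :
  closed S -> S y0 -> 0 <= r -> r < 1 -> (forall x, S x -> S (F x)) ->
  (forall x y, S x -> S y -> `|F x - F y| <= r * `|x - y|) ->
  exists2 y, S y & F y = y.
Proof.
move=> cS S0 r0 r1 SF cF.
pose y n := iter n F y0.
have Sy n : S (y n) by elim: n => //= n IH; exact: SF.
pose C := `|y 1%N - y 0%N| / (1 - r).
have r10 : 0 < 1 - r by rewrite subr_gt0.
have C0 : 0 <= C by rewrite mulr_ge0 // invr_ge0 ltW.
have step n : `|y n.+1 - y n| <= r ^+ n * (C * (1 - r)).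
  rewrite divfK ?gt_eqF //; elim: n => [|n IH]; first by rewrite mul1r.
  apply: (le_trans (cF _ _ (Sy n.+1) (Sy n))).
  by rewrite exprS -mulrA ler_wpM2l.
clearbody C.
have dist n m : `|y (n + m)%N - y n| <= C * r ^+ n * (1 - r ^+ m).
  elim: m => [|m IH]; first by rewrite addn0 subrr normr0 expr0 subrr mulr0.
  apply: (le_trans (ler_distD (y (n + m)%N) _ _)); rewrite addnS.
  apply: (le_trans (lerD (step _) IH)).
  by rewrite le_eqVlt; apply/orP; left; apply/eqP; rewrite exprD exprS; ring.
have dist' n m : (n <= m)%N -> `|y m - y n| <= C * r ^+ n.
  move=> /subnKC <-; apply: (le_trans (dist _ _)).
  rewrite -[leRHS]mulr1 ler_wpM2l ?mulr_ge0 ?exprn_ge0 //.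
  by rewrite gerBl exprn_ge0.
have small e : 0 < e -> exists n, C * r ^+ n < e.
  move=> e0; have C1 : 0 < C + 1 by rewrite ltr_wpDl.
  have [n hn] := complex_expr_small r0 r1 (divr_gt0 e0 C1).
  exists n; rewrite ltr_pdivlMr // mulrC in hn.
  by apply: le_lt_trans hn; rewrite ler_wpM2r ?exprn_ge0 // lerDl.
have cvy : cvgn y.
  apply/cauchy_cvgP; apply: cauchy_exP => e e0.
  have [n hn] := small e e0.
  exists (y n); exists n => // m /= nm; rewrite -ball_normE /= distrC.
  exact: le_lt_trans (dist' _ _ nm) hn.
pose l := limn y.
have approx e : 0 < e -> exists n, `|l - y n| < e /\ `|y n.+1 - y n| < e.
  move=> e0; have [N hN] := small e e0.
  have /cvgrPdist_lt /(_ _ e0) [M _ hM] := cvy.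
  exists (maxn M N); split; first by apply: hM; rewrite /= leq_maxl.
  apply: le_lt_trans hN; apply: (le_trans (dist' _ _ (leqnSn _))).
  by rewrite ler_wpM2l // ler_wiXn2l // ?ltW // leq_maxr.
have Sl : S l.
  apply: closed_norm_approx => // e /approx [n [h _]].
  by exists (y n).
exists l => //; apply/eqP; rewrite -subr_eq0 -normr_le0.
apply/ler_addgt0Pr => e e0; rewrite add0r.
have e3 : 0 < e / 3%:R by rewrite divr_gt0.
have [n [h1 h2]] := approx _ e3.
have -> : F l - l = (F l - F (y n)) + ((y n.+1 - y n) - (l - y n)).
  by rewrite -[F (y n)]/(y n.+1) opprB !addrA !subrK.
apply: (le_trans (ler_normD _ _)).
have h3 : `|F l - F (y n)| <= e / 3%:R.
  apply: (le_trans (cF _ _ Sl (Sy n))); apply: le_trans (ltW h1).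
  by rewrite ler_piMl // ltW.
have h4 := le_trans (ler_normB (y n.+1 - y n) (l - y n)) (lerD (ltW h2) (ltW h1)).
apply: (le_trans (lerD h3 h4)).
by rewrite le_eqVlt; apply/orP; left; apply/eqP; field.
Qed.

End FixedPoints.

(** * Self-adjoint elements, inverses and square roots *)

Section CStarBasics.

Variables (R : realType) (A : cstarAlgType R).
Implicit Types (x y z : A) (a : R[i]) (D S : set A).

Lemma star0 : star (0 : A) = 0.
Proof. by rewrite -[X in star X](scale0r (0 : A)) starZ rmorph0 scale0r. Qed.

Lemma starN x : star (- x) = - star x.
Proof. by rewrite -scaleN1r starZ rmorphN1 scaleN1r. Qed.

Lemma starB x y : star (x - y) = star x - star y.
Proof. by rewrite starD starN. Qed.

Lemma starZ_real a x : a \is Num.real -> star (a *: x) = a *: star x.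
Proof. by move=> ar; rewrite starZ conj_Creal. Qed.

Lemma norm_one : `|1 : A| = 1.
Proof.
have := norm_star_mul (1 : A); rewrite star_one mul1r => /esym/eqP.
rewrite expr2 -subr_eq0 -[X in _ - X]mulr1 -mulrBr mulf_eq0 normr_eq0.
by rewrite oner_eq0 subr_eq0 => /eqP.
Qed.

Lemma norm_star x : `|star x| = `|x|.
Proof.
have le y : `|y| <= `|star y|.
  have [->|y0] := eqVneq y 0; first by rewrite normr0 normr_ge0.
  rewrite -(ler_pM2r (_ : 0 < `|y|)) ?normr_gt0 // -expr2 -norm_star_mul.
  exact: norm_submult.
by apply/eqP; rewrite eq_le le andbT -[X in _ <= `|X|]starK le.
Qed.

Lemma norm_sqr x : star x = x -> `|x * x| = `|x| ^+ 2.
Proof. by move=> sx; rewrite -norm_star_mul sx. Qed.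

(** With z = x + iy, the C*-identity reads |x^2 + y^2| = |z|^2, and x is the
    real part of z.  This is what stands in for the positivity of squares. *)
Lemma norm_le_sum_sqr x y : star x = x -> star y = y -> x * y = y * x ->
  `|x| ^+ 2 <= `|x * x + y * y|.
Proof.
move=> sx sy xy; pose z := x + 'i *: y.
have sz : star z = x - 'i *: y by rewrite starD starZ conjCi sx sy scaleNr.
have -> : x * x + y * y = star z * z.
  rewrite sz mulrBl !mulrDr -!scalerAl -!scalerAr xy scalerA -(expr2 'i) sqrCi.
  by rewrite scaleN1r opprD opprK addrA addrK.
rewrite norm_star_mul lerXn2r ?nnegrE //.
have -> : x = 2^-1 *: (z + star z).
  rewrite sz addrACA subrr addr0 -(mulr2n x) -(scaler_nat 2 x) scalerA.
  by rewrite mulVf ?pnatr_eq0 // scale1r.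
rewrite normrZ ger0_norm ?invr_ge0 // mulrC ler_pdivrMr ?ltr0n //.
by rewrite (le_trans (ler_normD _ _)) // norm_star mulr_natr mulr2n.
Qed.

Lemma csub_N D x : is_cstar_subalgebra D -> D x -> D (- x).
Proof. by move=> cD Dx; rewrite -scaleN1r; apply: csub_Z. Qed.

Lemma csub_B D x y : is_cstar_subalgebra D -> D x -> D y -> D (x - y).
Proof. by move=> cD Dx Dy; apply: csub_D => //; apply: csub_N. Qed.

Lemma csub_setT : is_cstar_subalgebra [set: A].
Proof. by split=> //; exact: closedT. Qed.

(** The real and imaginary parts reduce every question about a *-closed set
    to its self-adjoint elements. *)
Lemma csub_cartesian D x : is_cstar_subalgebra D -> D x ->
  exists y z, [/\ D y, D z, star y = y, star z = z & x = y + 'i *: z].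
Proof.
move=> cD Dx; have Dsx := csub_star cD Dx.
exists (2^-1 *: (x + star x)), ((2^-1 * - 'i) *: (x - star x)); split.
- by apply: csub_Z => //; apply: csub_D.
- by apply: csub_Z => //; apply: csub_B.
- by rewrite starZ_real ?realV ?realn // starD starK addrC.
- rewrite starZ starB starK rmorphM rmorphN /= conjCi fmorphV rmorph_nat opprK.
  by rewrite mulrN scaleNr -scalerN opprB.
- rewrite scalerA mulrCA mulrN -expr2 sqrCi opprK mulr1 -scalerDr.
  rewrite addrACA subrr addr0 -(mulr2n x) -(scaler_nat 2 x) scalerA mulVf ?pnatr_eq0 //.
  by rewrite scale1r.
Qed.

Definition commutant S : set A := [set x | forall y, S y -> x * y = y * x].

Lemma commutant_subalgebra S : (forall y, S y -> S (star y)) ->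
  is_cstar_subalgebra (commutant S).
Proof.
move=> sS; split.
- by move=> y _; rewrite mul0r mulr0.
- by move=> x x' cx cx' y Sy; rewrite mulrDl mulrDr cx ?cx'.
- by move=> a x cx y Sy; rewrite -scalerAl -scalerAr cx.
- by move=> x x' cx cx' y Sy; rewrite -mulrA cx' // !mulrA cx.
- by move=> x cx y Sy; rewrite -[y in LHS]starK -starM -cx ?starM ?starK //; apply: sS.
- apply: norm_closed => x hx y Sy; apply/eqP; rewrite -subr_eq0 -normr_le0.
  apply/ler_addgt0Pr => e e0; rewrite add0r.
  have y1 : 0 < (`|y| + 1) *+ 2 by rewrite pmulrn_lgt0 // ltr_wpDl.
  have [x' cx' xx'] := hx _ (divr_gt0 e0 y1).
  have -> : x * y - y * x = (x - x') * y - y * (x - x').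
    by rewrite mulrBl mulrBr (cx' y Sy) opprB addrA subrK.
  rewrite ltr_pdivlMr // -mulr_natr mulrA in xx'.
  apply: le_trans (ler_normB _ _) _; apply: le_trans (ltW xx').
  rewrite mulr_natr mulr2n lerD // (le_trans (norm_submult _ _)) //.
    by rewrite ler_wpM2l // lerDl.
  by rewrite mulrC ler_wpM2l // lerDl.
Qed.

Definition center : set A := commutant setT.

Lemma center_subalgebra : is_cstar_subalgebra center.
Proof. exact: commutant_subalgebra. Qed.

Lemma center1 : center 1.
Proof. by move=> y _; rewrite mul1r mulr1. Qed.

(** Neumann: the inverse of 1 - x is the fixed point of y |-> 1 + x y.  Iterating
    inside D keeps the inverse in D. *)
Lemma csub_inverse D x : is_cstar_subalgebra D -> D 1 -> D x -> `|x| < 1 ->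
  exists2 y, D y & (1 - x) * y = 1.
Proof.
move=> cD D1 Dx x1.
have [y Dy yE] : exists2 y, D y & 1 + x * y = y.
  apply: (contraction_fixpoint (csub_closed cD) D1 (normr_ge0 x) x1).
    by move=> y Dy; apply: csub_D => //; apply: csub_M.
  move=> y z _ _.
  by rewrite opprD addrACA subrr add0r -mulrBr norm_submult.
by exists y => //; rewrite mulrBl mul1r -{1}yE addrK.
Qed.

Lemma closed_selfadjoint : closed [set x : A | star x = x].
Proof.
apply: norm_closed => x hx /=; apply/eqP; rewrite -subr_eq0 -normr_le0.
apply/ler_addgt0Pr => e e0; rewrite add0r.
have e2 : 0 < e / 2 by rewrite divr_gt0.
have [y /= sy xy] := hx _ e2.
have -> : star x - x = star (x - y) - (x - y).
  by rewrite starB sy opprB addrA subrK.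
by rewrite (le_trans (ler_normB _ _)) // norm_star (splitr e) lerD // ltW.
Qed.

Lemma closed_norm_le (r : R[i]) : closed [set x : A | `|x| <= r].
Proof.
apply: norm_closed => x hx /=; apply/ler_addgt0Pr => e e0.
have [y /= yr xy] := hx _ e0.
by rewrite -(subrK y x) addrC (le_trans (ler_normD _ _)) // lerD // ltW.
Qed.

(** A root 1 - y of 1 - x satisfies y = (x + y^2) / 2.  On the ball of radius
    r = |x| < 1 the right-hand side has norm at most (r + r^2) / 2 <= r and is
    r-Lipschitz, so the fixed point exists, and it stays self-adjoint and in D. *)
Lemma csub_sqrt D x : is_cstar_subalgebra D -> D 1 -> D x -> star x = x ->
  `|x| < 1 -> exists y, [/\ D y, star y = y & y * y = 1 - x].
Proof.
move=> cD D1 Dx sx x1; set r := `|x| in x1 *.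
have r0 : 0 <= r by exact: normr_ge0.
pose S := D `&` [set y : A | star y = y] `&` [set y | `|y| <= r].
have cS : closed S.
  apply: closedI; last exact: closed_norm_le.
  by apply: closedI; [exact: csub_closed | exact: closed_selfadjoint].
have S0 : S 0.
  split; last by rewrite /= normr0.
  by split; [exact: csub_0 | rewrite /= star0].
have [y [[Dy /= sy] _] yE] : exists2 y, S y & 2^-1 *: (x + y * y) = y.
  apply: (contraction_fixpoint cS S0 r0 x1).
    move=> y [[Dy /= sy] /= yr]; split; last first.
      rewrite /= normrZ ger0_norm ?invr_ge0 // mulrC ler_pdivrMr ?ltr0n //.
      rewrite (le_trans (ler_normD _ _)) // mulr_natr mulr2n lerD //.
      rewrite (le_trans (norm_submult _ _)) // -[leRHS]mulr1.
      by rewrite ler_pM // (le_trans yr) // ltW.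
    split; first by apply: csub_Z => //; apply: csub_D => //; apply: csub_M.
    by rewrite /= starZ_real ?realV ?realn // starD starM sy sx.
  move=> y z [_ /= yr] [_ /= zr].
  have -> : 2^-1 *: (x + y * y) - 2^-1 *: (x + z * z) =
      2^-1 *: ((y - z) * y + z * (y - z)).
    rewrite -scalerBr opprD addrACA subrr add0r mulrBl mulrBr.
    by rewrite addrA subrK.
  rewrite normrZ ger0_norm ?invr_ge0 // mulrC ler_pdivrMr ?ltr0n //.
  rewrite (le_trans (ler_normD _ _)) // mulr_natr mulr2n lerD //.
    by rewrite (le_trans (norm_submult _ _)) // mulrC ler_wpM2r.
  by rewrite (le_trans (norm_submult _ _)) // ler_wpM2r.
exists (1 - y); split; first exact: csub_B.
  by rewrite starB star_one sy.
have y2 : y * y = y + y - x.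
  have -> : y + y = x + y * y.
    rewrite -mulr2n -(scaler_nat 2 y) -[in LHS]yE scalerA mulfV ?pnatr_eq0 //.
    by rewrite scale1r.
  by rewrite addrC addKr.
have y3 : y - (y + y - x) = x - y.
  by rewrite -addrA opprD addrA subrr add0r opprB.
by rewrite mulrBl mul1r mulrBr mulr1 y2 y3 opprB addrA subrK.
Qed.

End CStarBasics.

(** * The center of a simple C*-algebra *)

Section SimpleCenter.

Variables (R : realType) (A : cstarAlgType R).
Hypothesis simple_A : cstar_simple A.
Implicit Types (h x y z : A).

(** The closure of z A is a nonzero closed ideal, hence contains 1; so z y is
    within distance 1 of 1 for some y, and z is invertible. *)
Lemma simple_central_inverse z : center z -> z != 0 ->
  exists2 y, center y & z * y = 1.
Proof.
move=> cz z0.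
(* J is the closure of z A. *)
pose J := [set x : A | forall e, 0 < e -> exists y, `|x - z * y| < e].
(* An ideal is stable under scalars and one-sided multiplications, which are
   all maps of this bounded kind. *)
have Jbounded (f : A -> A) (M : R[i]) x : 0 <= M ->
    (forall y, exists y', `|f x - z * y'| <= M * `|x - z * y|) ->
    J x -> J (f x).
  move=> M0 hf Ix e e0.
  have M1 : 0 < M + 1 by rewrite ltr_wpDl.
  have [y] := Ix _ (divr_gt0 e0 M1); have [y' hy'] := hf y.
  rewrite ltr_pdivlMr // mulrC => hy; exists y'.
  apply: le_lt_trans hy; apply: (le_trans hy').
  by rewrite ler_wpM2r // lerDl.
have idJ : is_closed_ideal J.
  split.
  - by move=> e e0; exists 0; rewrite mulr0 subrr normr0.
  - move=> x y Ix Iy e e0; have e2 : 0 < e / 2 by rewrite divr_gt0.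
    have [x' hx] := Ix _ e2; have [y' hy] := Iy _ e2; exists (x' + y').
    rewrite mulrDr opprD addrACA (le_lt_trans (ler_normD _ _)) //.
    by rewrite (splitr e) ltrD.
  - move=> a x; apply: Jbounded (normr_ge0 a) _ => y; exists (a *: y).
    by rewrite -scalerAr -scalerBr normrZ.
  - move=> a x; apply: Jbounded (normr_ge0 a) _ => y; exists (a * y).
    by rewrite mulrA (cz a) // -mulrA -mulrBr norm_submult.
  - move=> a x; apply: (Jbounded (fun x => x * a)) (normr_ge0 a) _ => y.
    by exists (y * a); rewrite mulrA -mulrBl mulrC norm_submult.
  - apply: norm_closed => x hx e e0; have e2 : 0 < e / 2 by rewrite divr_gt0.
    have [y Iy xy] := hx _ e2; have [y' yy'] := Iy _ e2; exists y'.
    rewrite -(subrK y x) -addrA (le_lt_trans (ler_normD _ _)) //.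
    by rewrite (splitr e) ltrD.
have Jz : J z by move=> e e0; exists 1; rewrite mulr1 subrr normr0.
have [J0|JT] := simple_A idJ.
  by move: Jz; rewrite J0 /= => /eqP; rewrite (negPf z0).
have J1 : J 1 by rewrite JT.
have [y hy] := J1 _ ltr01.
have [x _] := csub_inverse (csub_setT A) I (D := setT) (x := 1 - z * y) I hy.
rewrite opprB addrC subrK -mulrA; set b := y * x => zb; exists b => // w _.
have bz : b * z = 1 by rewrite -cz.
by rewrite -[LHS]mulr1 -zb mulrA -[b * w * z]mulrA -cz // mulrA bz mul1r.
Qed.

(** Otherwise 1 - h^2 is invertible with inverse b, which keeps h^2 away from 1.
    Write 1 - (dh)^2 = k^2 with d < 1 and 1 - de b = l^2 with de > 0 small.  Then
      (dh)^2 + (kl)^2 = (1 - de) - de (1 - d^2) h^2 b,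
    whose norm is at least d^2.  As d tends to 1 the right-hand side tends to
    1 - de while d^2 tends to 1, a contradiction. *)
Lemma simple_central_sqr h : center h -> star h = h -> `|h| = 1 -> h * h = 1.
Proof.
move=> ch sh nh; apply/eqP; apply: contraT => h1.
pose x := 1 - h * h.
have cA := center_subalgebra A; have c1 := @center1 R A.
have chh : center (h * h) by exact: (csub_M cA).
have cx : center x by exact: (csub_B cA).
have [|b cb xb] := simple_central_inverse cx; first by rewrite subr_eq0 eq_sym.
have sb : star b = b.
  have sx : star x = x by rewrite starB star_one starM sh.
  have bx : star b * x = 1 by rewrite -sx -starM xb star_one.
  by rewrite -[LHS]mulr1 -xb mulrA bx mul1r.
have [m m0 bm] : exists2 m : R, 0 <= m & `|b| = (m%:C)%C.
  exists (complex.Re `|b|); last by rewrite RRe_real // ger0_real.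
  by rewrite -ler0c RRe_real // ger0_real.
(* de |b| < 1/2, and d is so close to 1 that d^2 > 1 - 2 de / 3. *)
pose de : R := (2 * (m + 1))^-1; pose d : R := 1 - de / 4.
have deE : de * (m + 1) = 2^-1.
  by rewrite /de; field; rewrite gt_eqF // ltr_wpDl.
have de0 : 0 < de by rewrite invr_gt0 mulr_gt0 // ltr_wpDl.
have de1 : de <= 2^-1 by nra.
have d0 : 0 < d by rewrite /d; lra.
have d1 : d < 1 by rewrite /d; lra.
have dC : (d%:C)%C \is Num.real by rewrite complex_real.
have deC : (de%:C)%C \is Num.real by rewrite complex_real.
pose g := (d%:C)%C *: h.
have cg : center g by exact: (csub_Z cA).
have sg : star g = g by rewrite starZ_real // sh.
have ng : `|g| = (d%:C)%C by rewrite normrZ nh mulr1 ger0_norm // ler0c ltW.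
have [k [ck sk kk]] : exists y, [/\ center y, star y = y & y * y = 1 - g * g].
  apply: (csub_sqrt cA) => //; first exact: (csub_M cA); first by rewrite starM sg.
  by rewrite norm_sqr // ng -rmorphXn /= -(rmorph1 (real_complex R)) ltcR; nra.
have [l [cl sl ll]] :
    exists y, [/\ center y, star y = y & y * y = 1 - (de%:C)%C *: b].
  apply: (csub_sqrt cA) => //; first exact: (csub_Z cA); first by rewrite starZ_real // sb.
  rewrite normrZ bm ger0_norm ?ler0c ?ltW //.
  by rewrite -rmorphM /= -(rmorph1 (real_complex R)) ltcR; nra.
have ckl : center (k * l) by exact: (csub_M cA).
have skl : star (k * l) = k * l by rewrite starM sk sl -ck.
have := norm_le_sum_sqr sg skl (cg _ I).
have -> : g * g + k * l * (k * l) =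
    (1 - de)%:C%C *: 1 - (de * (1 - d ^+ 2))%:C%C *: (h * h * b).
  have -> : k * l * (k * l) = (k * k) * (l * l).
    by rewrite -!mulrA; congr (_ * _); rewrite mulrA -ck // mulrA.
  rewrite kk ll mulrBr mulr1 addrA [g * g + _]addrC subrK.
  have -> : (1 - g * g) * ((de%:C)%C *: b) =
      (de%:C)%C *: 1 + (de * (1 - d ^+ 2))%:C%C *: (h * h * b).
    rewrite -scalerAr rmorphM -scalerA -scalerDr; congr (_ *: _).
    have xb' : b - h * h * b = 1 by rewrite -xb mulrBl mul1r.
    rewrite -[X in _ = X + _]xb' mulrBl mul1r /g -!scalerAl -scalerAr -!scalerAl.
    by rewrite scalerA -rmorphM -expr2 rmorphB rmorph1 scalerBl scale1r addrA subrK.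
  by rewrite opprD addrA rmorphB rmorph1 scalerBl scale1r.
rewrite ng => le1.
have := le_trans le1 (ler_normB _ _).
rewrite !normrZ norm_one mulr1.
have -> : `|(1 - de)%:C%C| = (1 - de)%:C%C by rewrite ger0_norm // ler0c; lra.
have -> : `|(de * (1 - d ^+ 2))%:C%C| = (de * (1 - d ^+ 2))%:C%C.
  by rewrite ger0_norm // ler0c; nra.
have nhb : `|h * h * b| <= m%:C%C.
  by rewrite (le_trans (norm_submult _ _)) // bm norm_sqr // nh expr1n mul1r.
move=> le2.
have d2 : 0 <= de * (1 - d ^+ 2) by nra.
have le3 := le_trans le2 (lerD (lexx _) (ler_wpM2l _ nhb)).
rewrite ler0c in le3; have {le3} := le3 d2.
rewrite -rmorphXn -rmorphM -rmorphD /= lecR.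
by rewrite /d; nra.
Qed.

(** A normalized self-adjoint central g has (g - 1)(g + 1) = 0, and nonzero
    central elements are invertible, so g = 1 or g = -1. *)
Lemma simple_center z : center z -> exists a : R[i], z = a *: 1.
Proof.
have cA := center_subalgebra A.
suff sa h : center h -> star h = h -> exists a : R[i], h = a *: 1.
  move=> cz; have [x [y [cx cy sx sy ->]]] := csub_cartesian cA cz.
  have [a ->] := sa x cx sx; have [b ->] := sa y cy sy.
  by exists (a + 'i * b); rewrite scalerDl scalerA.
move=> ch sh.
have [->|h0] := eqVneq h 0; first by exists 0; rewrite scale0r.
have n0 : `|h| != 0 by rewrite normr_eq0.
pose g := `|h|^-1 *: h.
have hg : h = `|h| *: g by rewrite scalerA mulfV // scale1r.
have cg : center g by exact: (csub_Z cA).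
have g2 : g * g = 1.
  apply: simple_central_sqr => //.
    by rewrite starZ_real ?sh // realV normr_real.
  by rewrite normrZ ger0_norm ?invr_ge0 // mulVf.
have [g1|g1] := eqVneq (g - 1) 0.
  by exists `|h|; rewrite {1}hg; move/subr0_eq: g1 => ->.
have [|y cy gy] := simple_central_inverse _ g1.
  by apply: (csub_B cA) => //; exact: center1.
exists (- `|h|); rewrite {1}hg scaleNr -scalerN; congr (_ *: _).
have gE : g + 1 = (g + 1) * ((g - 1) * y) by rewrite gy mulr1.
apply/eqP; rewrite -subr_eq0 opprK gE mulrA.
by rewrite mulrDl mul1r !mulrBr g2 mulr1 addrC subrKA subrr mul0r.
Qed.

End SimpleCenter.

(** * Commutants and maximal abelian subalgebras *)

Section Commutants.

Variables (R : realType) (A : cstarAlgType R).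
Implicit Types (x y z : A) (D S : set A).

Lemma cstar_generated_subalgebra S : is_cstar_subalgebra (cstar_generated S).
Proof.
split.
- by move=> E [cE _]; exact: (csub_0 cE).
- by move=> x y hx hy E SE; apply: (csub_D (proj1 SE)); [exact: hx | exact: hy].
- by move=> a x hx E SE; apply: (csub_Z (proj1 SE)); exact: hx.
- by move=> x y hx hy E SE; apply: (csub_M (proj1 SE)); [exact: hx | exact: hy].
- by move=> x hx E SE; apply: (csub_star (proj1 SE)); exact: hx.
- by apply: closed_bigI => E [cE _]; exact: csub_closed.
Qed.

(** The C*-algebra generated by S lies in the commutant of the *-closed set
    {x, x^*}, as S does. *)
Lemma commutant_generated S : (forall y, S y -> S (star y)) ->
  commutant S `<=` commutant (cstar_generated S).
Proof.
move=> sS x cx y.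
have csx := csub_star (commutant_subalgebra sS) cx.
have cT : is_cstar_subalgebra (commutant [set x; star x]).
  apply: commutant_subalgebra => z [->|->]; first by right.
  by left; rewrite starK.
suff ST : S `<=` commutant [set x; star x].
  by move=> /(smallest_sub cT ST) /(_ x) -> //; left.
by move=> z Sz w [->|->]; rewrite ?cx ?csx.
Qed.

Lemma cstar_generated_commutative S : (forall y, S y -> S (star y)) ->
  commutative_set S -> commutative_set (cstar_generated S).
Proof.
move=> sS cS x y; move: x.
have sT := cstar_generated_subalgebra S.
suff h : cstar_generated S `<=` commutant (cstar_generated S).
  by move=> x hx hy; exact: h.
apply: smallest_sub.
  by apply: commutant_subalgebra => z; exact: csub_star.
by move=> x Sx; apply: commutant_generated => // y' Sy'; exact: cS.
Qed.

(** A self-adjoint v commuting with D generates with D a commutative algebra,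
    which is D by maximality. *)
Lemma masa_commutant D : maximal_abelian_subalgebra D -> commutant D `<=` D.
Proof.
move=> [cD comD maxD] x cx.
have cC : is_cstar_subalgebra (commutant D).
  by apply: commutant_subalgebra => z; exact: csub_star.
have [y [z [cy cz sy sz ->]]] := csub_cartesian cC cx.
suff h v : commutant D v -> star v = v -> D v.
  by apply: csub_D => //; [exact: h | apply: csub_Z => //; exact: h].
move=> cv sv; pose S := D `|` [set v].
have SD : S `<=` cstar_generated S by exact: sub_gen_smallest.
rewrite -(maxD (cstar_generated S)).
- by apply: SD; right.
- exact: cstar_generated_subalgebra.
- apply: cstar_generated_commutative.
    by move=> w [Dw|->]; [left; exact: csub_star | right; rewrite /= sv].
  move=> w w' [Dw|->] [Dw'|->] //; [exact: comD | by rewrite cv | exact: cv].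
- by move=> w Dw; apply: SD; left.
Qed.

Lemma masa_one D : maximal_abelian_subalgebra D -> D 1.
Proof.
by move=> mD; apply: (masa_commutant mD) => y _; rewrite mul1r mulr1.
Qed.

End Commutants.

Section StarHomomorphisms.

Variables (R : realType) (A B : cstarAlgType R) (f : A -> B).
Hypothesis hf : is_star_hom f.

Let f_linear : linear f. Proof. by case: hf. Qed.

Lemma star_hom0 : f 0 = 0.
Proof. by have := f_linear (-1) 0 0; rewrite scaler0 addr0 scaleN1r addNr. Qed.

Lemma star_homZ (a : R[i]) x : f (a *: x) = a *: f x.
Proof. by rewrite -[a *: x]addr0 f_linear star_hom0 addr0. Qed.

Lemma star_homD x y : f (x + y) = f x + f y.
Proof. by rewrite -[x]scale1r f_linear !scale1r. Qed.

Lemma star_hom1 : f 1 = 1.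
Proof. by case: hf => _ []. Qed.

Lemma star_homM x y : f (x * y) = f x * f y.
Proof. by case: hf => _ []. Qed.

End StarHomomorphisms.

(** * Automorphisms *)

Section InnerAutomorphisms.

Variables (R : realType) (A : cstarAlgType R).

Lemma inner_aut_subproof (w : A) : star w * w = 1 -> w * star w = 1 ->
  is_star_hom (fun x => w * x * star w) /\
  bijective (fun x => w * x * star w).
Proof.
move=> ww ww'; split; last first.
  exists (fun x => star w * x * w) => x.
    by rewrite !mulrA ww mul1r -mulrA ww mulr1.
  by rewrite !mulrA ww' mul1r -mulrA ww' mulr1.
split.
- by move=> a x y; rewrite mulrDr mulrDl -scalerAr -scalerAl.
- split=> [|x y]; first by rewrite mulr1.
  by rewrite !mulrA -(mulrA (w * x) (star w)) ww mulr1.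
- by move=> x; rewrite !starM starK mulrA.
Qed.

Definition inner_aut (w : A) (ww : star w * w = 1) (ww' : w * star w = 1) :
  star_aut A := exist _ _ (inner_aut_subproof ww ww').

Lemma star_aut_mulE (f g : star_aut A) x :
  sval (f * g)%g x = sval f (sval g x).
Proof. by []. Qed.

Lemma star_aut_VK (f : star_aut A) x : sval (f^-1)%g (sval f x) = x.
Proof. by rewrite -star_aut_mulE mulVg. Qed.

Lemma aut_fixing_subgroup (D : set A) : is_subgroup (aut_fixing D).
Proof.
split=> [//|f g hf hg x Dx|f hf x Dx]; first by rewrite star_aut_mulE hg ?hf.
by rewrite -{1}(hf x Dx) star_aut_VK.
Qed.

End InnerAutomorphisms.

(** * Automorphisms commuting with Aut_D in a simple C*-algebra *)

Section AutomorphismsOfSimpleAlgebras.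

Variables (R : realType) (A : cstarAlgType R) (D : set A).
Hypothesis simple_A : cstar_simple A.
Hypothesis masa_D : maximal_abelian_subalgebra D.

Let cD : is_cstar_subalgebra D. Proof. by case: masa_D. Qed.
Let comD : commutative_set D. Proof. by case: masa_D. Qed.
Let D1 : D 1. Proof. exact: masa_one. Qed.

(** Since f commutes with conjugation by w, conjugations by f(w) and by w agree,
    so w^* f(w) is central. *)
Lemma commuting_aut_scales_unitary (f : star_aut A) w :
  (forall g, aut_fixing D g -> (f * g = g * f)%g) ->
  D w -> star w * w = 1 -> w * star w = 1 ->
  exists a : R[i], sval f w = a *: w.
Proof.
move=> cf Dw ww ww'; have hf : is_star_hom (sval f) by case: (svalP f).
have [f' _ f'K] : bijective (sval f) by case: (svalP f).
have fix_g : aut_fixing D (inner_aut ww ww').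
  by move=> x Dx /=; rewrite (comD Dw Dx) -mulrA ww' mulr1.
suff /(simple_center simple_A) [a za] : center (star w * sval f w).
  by exists a; rewrite -[LHS]mul1r -ww' -mulrA za -scalerAr mulr1.
move=> y _; have /= := congr1 (fun g => sval g (f' y)) (cf _ fix_g).
rewrite !(star_homM hf) f'K => h.
have fw : sval f (star w) * sval f w = 1.
  by rewrite -star_homM // ww star_hom1.
have -> : star w * sval f w * y =
    star w * (sval f w * y * sval f (star w)) * sval f w.
  by rewrite !mulrA -[RHS]mulrA fw mulr1.
by rewrite h !mulrA ww mul1r.
Qed.

(** For imaginary s, the Cayley transform w = (1 + sh) / (1 - sh) is a unitary of
    D, so f(w) = la w.  With k = f(h), clearing denominators gives
      la (1 + sh)(1 - sk) = (1 - sh)(1 + sk),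
    that is (1 - la)(1 - s^2 hk) = (1 + la) s (h - k). *)
Lemma cayley_relation (f : star_aut A) (h : A) (s : R[i]) :
  (forall g, aut_fixing D g -> (f * g = g * f)%g) ->
  D h -> star h = h -> s != 0 -> Num.conj s = - s -> `|s| * `|h| < 1 ->
  sval f h = h \/
  exists a : R[i], 1 - s ^+ 2 *: (h * sval f h) = a *: (h - sval f h).
Proof.
move=> cf Dh sh s0 cs hs; have hf : is_star_hom (sval f) by case: (svalP f).
set k := sval f h.
(* b s and b (- s) are numerator and denominator, and e inverts the latter. *)
pose b (t : R[i]) : A := 1 + t *: h.
have Db t : D (b t) by apply: csub_D => //; exact: csub_Z.
have fb t : sval f (b t) = 1 + t *: k.
  by rewrite star_homD // star_hom1 // star_homZ.
have expand t : b t * sval f (b (- t)) =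
    1 + t *: (h - k) - t ^+ 2 *: (h * k).
  rewrite fb /b mulrDr mulr1 mulrDl mul1r -scalerAl -scalerAr scalerA mulrN.
  by rewrite -(expr2 t) !scaleNr scalerBr !addrA.
have [e De eE] : exists2 e, D e & b (- s) * e = 1.
  have [||e De eE] := csub_inverse cD D1 (x := s *: h).
  - exact: csub_Z.
  - by rewrite normrZ.
  by exists e => //; rewrite /b scaleNr.
have sb : star (b (- s)) = b s.
  by rewrite starD star_one starZ sh rmorphN /= cs opprK.
pose w := b s * e.
have Dw : D w by exact: csub_M.
have ww : star w * w = 1.
  have sb' : star (b s) = b (- s) by rewrite -sb starK.
  rewrite starM sb' mulrA -(mulrA (star e)) (comD (Db _) (Db _)) mulrA -mulrA.
  by rewrite eE mulr1 -sb -starM eE star_one.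
have ww' : w * star w = 1 by rewrite (comD Dw) //; exact: csub_star.
have [la fw] := commuting_aut_scales_unitary cf Dw ww ww'.
have aw : b (- s) * w = b s.
  by rewrite (comD (Db _) Dw) -mulrA (comD De (Db _)) eE mulr1.
have wa : w * b (- s) = b s by rewrite (comD Dw (Db _)).
clearbody w.
have fbs : sval f (b s) = la *: (w * sval f (b (- s))).
  by rewrite -wa star_homM // fw scalerAl.
have main : la *: (b s * sval f (b (- s))) = b (- s) * sval f (b s).
  by rewrite fbs -scalerAr mulrA aw.
have expand' : b (- s) * sval f (b s) =
    1 - s *: (h - k) - s ^+ 2 *: (h * k).
  by rewrite -[X in sval f (b X)]opprK expand scaleNr sqrrN.
rewrite expand expand' in main.
have [la1|la1] := eqVneq la 1.
  left; move: main; rewrite la1 scale1r => /addIr/addrI/eqP.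
  rewrite -subr_eq0 opprK -scalerDr scaler_eq0 (negPf s0) /=.
  rewrite -mulr2n -scaler_nat scaler_eq0 pnatr_eq0 /= subr_eq0.
  by move/eqP.
right; exists ((1 - la)^-1 * ((1 + la) * s)).
have la2 : 1 - la != 0 by rewrite subr_eq0 eq_sym.
apply: (scalerI la2); rewrite [RHS]scalerA mulrA mulfV // mul1r -[RHS]scalerA.
move: main; set y := s *: (h - k); set x := s ^+ 2 *: _ => main.
have {}main : la *: (1 - x) + la *: y = 1 - x - y.
  by rewrite -scalerDr addrAC main addrAC.
rewrite scalerBl scale1r scalerDl scale1r; apply/eqP.
by rewrite subr_eq -addrA [la *: y + _]addrC main addrC subrK.
Qed.

(** The relations for s and 2s eliminate h f(h) and leave a nonzero scalar equal to
    a multiple of h - f(h), so f(h) = h + a with a scalar.  Likewise f(h^2) = h^2 + c,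
    and expanding (h + a)^2 gives 2 a h = c - a^2; if a is nonzero then h is
    scalar, hence fixed. *)
Lemma commuting_aut_fixes_selfadjoint (f : star_aut A) (h : A) :
  (forall g, aut_fixing D g -> (f * g = g * f)%g) ->
  D h -> star h = h -> sval f h = h.
Proof.
move=> cf; have hf : is_star_hom (sval f) by case: (svalP f).
have shift v : D v -> star v = v -> exists a : R[i], sval f v = v + a *: 1.
  move=> Dv sv; pose n := `|v| + 1.
  have n0 : 0 < n by rewrite ltr_wpDl.
  pose s : R[i] := 'i / (2 * n).
  have s0 : s != 0 by rewrite mulf_neq0 ?neq0Ci // invr_neq0 // mulf_neq0 ?gt_eqF.
  have cs : Num.conj s = - s.
    rewrite rmorphM /= conjCi mulNr conj_Creal // realV ger0_real //.
    by rewrite mulr_ge0 // ltW.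
  have ns : `|2 * s| * `|v| < 1.
    have -> : 2 * s = 'i / n by rewrite /s; field; rewrite gt_eqF.
    rewrite normrM normCi mul1r ger0_norm ?invr_ge0 1?ltW // mulrC.
    by rewrite ltr_pdivrMr // mul1r ltrDl.
  clearbody s.
  have ns' : `|s| * `|v| < 1.
    apply: le_lt_trans ns; rewrite ler_wpM2r // normrM ger0_norm //.
    by rewrite ler_peMl // ler1n.
  have [fv|[a ha]] := cayley_relation cf Dv sv s0 cs ns'.
    by exists 0; rewrite scale0r addr0.
  have [||fv|[c hc]] := @cayley_relation f v (2 * s) cf Dv sv _ _ ns.
  - by rewrite mulf_neq0 ?pnatr_eq0.
  - by rewrite rmorphM /= cs rmorph_nat mulrN.
  - by exists 0; rewrite scale0r addr0.
  (* 4 (1 - s^2 X) - (1 - (2s)^2 X) = 3 for X = v f(v). *)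
  have main : (4 * a - c) *: (v - sval f v) = 3 *: 1.
    have e4 x : (2 * s) ^+ 2 *: x = 4 *: (s ^+ 2 *: x).
      by rewrite scalerA; congr (_ *: _); ring.
    rewrite scalerBl -scalerA -ha -hc e4 scalerBr opprB addrA subrK.
    by rewrite -[X in _ - X = _]scale1r -scalerBl; congr (_ *: _); ring.
  have ac : 4 * a - c != 0.
    apply/eqP => ac; move: main; rewrite ac scale0r => /esym/eqP.
    by rewrite scaler_eq0 pnatr_eq0 oner_eq0.
  exists (- ((4 * a - c)^-1 * 3)); rewrite scaleNr -scalerA -main scalerA.
  by rewrite mulVf // scale1r opprB addrCA subrr addr0.
move=> Dh sh; have [a fh] := shift h Dh sh.
have [a0|a0] := eqVneq a 0; first by rewrite fh a0 scale0r addr0.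
have [|c fhh] := shift (h * h) (csub_M cD Dh Dh); first by rewrite starM sh.
have [c' hc] : exists c' : R[i], h = c' *: 1.
  have a2 : a + a != 0 by rewrite -mulr2n mulrn_eq0.
  exists ((a + a)^-1 * (c - a * a)); apply: (scalerI a2).
  rewrite [RHS]scalerA mulrA mulfV // mul1r.
  move: fhh; rewrite star_homM // fh mulrDr !mulrDl -!scalerAl -!scalerAr.
  rewrite !mulr1 mul1r scalerA -addrA => /addrI; rewrite addrA -scalerDl.
  by rewrite scalerBl => <-; rewrite addrK.
by rewrite hc star_homZ // star_hom1.
Qed.

Lemma masa_maximal_abelian_aut :
  (forall f g, aut_fixing D f -> aut_fixing D g -> (f * g = g * f)%g) ->
  maximal_abelian_subgroup (aut_fixing D).
Proof.
move=> cAut; split; first by split; [exact: aut_fixing_subgroup | exact: cAut].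
move=> K [sK cK] DK; apply/seteqP; split=> // f Kf x Dx.
have hf : is_star_hom (sval f) by case: (svalP f).
have cf g : aut_fixing D g -> (f * g = g * f)%g by move=> /DK; exact: cK.
have [y [z [Dy Dz sy sz ->]]] := csub_cartesian cD Dx.
by rewrite star_homD // star_homZ // !(commuting_aut_fixes_selfadjoint cf).
Qed.

End AutomorphismsOfSimpleAlgebras.
(** * Automorphisms of the boundary quotient fixing C*(G) *)

Section Transversals.

Variable G : groupType.
Implicit Types (H : set G) (T : seq G).

Lemma finite_index_transversal H : finite_index H ->
  exists T, left_transversal H T.
Proof.
move=> /finite_seqP [cs csE].
have ex c : exists t, c \in cs -> left_coset H t = c.
  have [cin|] := boolP (c \in cs); last by exists 1%g.
  have : [set` cs] c by [].
  by rewrite -csE => -[t _ <-]; exists t.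
have [rep repE] := choice ex.
exists [seq rep c | c <- undup cs]; split.
  rewrite map_inj_in_uniq ?undup_uniq // => c c'.
  rewrite !mem_undup => /repE {2}<- /repE {2}<- -> //.
move=> g; have gcs : left_coset H g \in cs.
  by have : [set` cs] (left_coset H g) by rewrite -csE; exists g.
exists (rep (left_coset H g)); split.
  by split; [apply: map_f; rewrite mem_undup | rewrite repE].
move=> t [/mapP [c]]; rewrite mem_undup => ccs ->.
by rewrite repE // => ->.
Qed.

End Transversals.

Section BoundaryQuotientAutomorphisms.

Variables (R : realType) (G : groupType) (P : monoidType).
Variables (theta : P -> G -> G) (A : cstarAlgType R) (u : G -> A) (s : P -> A).
Hypothesis action : is_injective_action theta.
Hypothesis finite_N : forall p : P, finite_index (range (theta p)).
Hypothesis bq : is_boundary_quotient theta u s.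
Hypothesis masa : maximal_abelian_subalgebra (cstar_generated (range u)).

Let rels : boundary_relations theta u s. Proof. by case: bq. Qed.
Let D := cstar_generated (range u).

Lemma theta_one p : theta p 1%g = 1%g.
Proof.
have := act_morph action p 1%g 1%g; rewrite mulg1 => h.
by rewrite -[RHS](mulgV (theta p 1%g)) {2}h mulgK.
Qed.

Lemma theta_coset p t g : left_coset (range (theta p)) t =
  left_coset (range (theta p)) g <-> exists h, g = (t * theta p h)%g.
Proof.
split=> [|[h ->]].
  move=> e; have : left_coset (range (theta p)) g g.
    by exists 1%g; [exists 1%g; rewrite ?theta_one | rewrite mulg1].
  by rewrite -e => -[_ [h _ <-] <-]; exists h.
apply/seteqP; split=> _ [_ [k _ <-] <-].
  exists (theta p (h^-1 * k)%g); first by exists (h^-1 * k)%g.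
  by rewrite -mulgA -act_morph // mulgA mulgV mul1g.
exists (theta p (h * k)%g); first by exists (h * k)%g.
by rewrite act_morph // mulgA.
Qed.

Lemma star_u g : star (u g) = u (g^-1)%g.
Proof.
have U := rel_unitary rels.
rewrite -[LHS]mulr1 -(urep_one U) -(mulgV g) (urep_mul U) mulrA.
by rewrite (urep_starl U) mul1r.
Qed.

Lemma u_in_D g : D (u g).
Proof. by apply: sub_gen_smallest; exists g. Qed.

Lemma range_u_star y : range u y -> range u (star y).
Proof. by move=> [g _ <-]; rewrite star_u; exists (g^-1)%g. Qed.

Lemma covariance_star p h : star (s p) * u (theta p h) * s p = u h.
Proof.
by rewrite -mulrA -(rel_I rels) mulrA (irep_star (rel_isometric rels)) mul1r.
Qed.

Lemma corner_zero p g : ~ (exists h, g = theta p h) ->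
  star (s p) * u g * s p = 0.
Proof.
move=> ng; apply: (rel_II_zero rels) => -[g1 [g2 [p' [q' [gE _ _]]]]].
by apply: ng; exists (g1 * g2)%g; rewrite act_morph.
Qed.

(** By [rel_III] the projections u_g s_p s_p^* u_g^* sum to 1 over the cosets,
    so an element of A is determined by its products with the u_g s_p. *)
Lemma separate_by_ranges p y : (forall g, y * (u g * s p) = 0) -> y = 0.
Proof.
move=> y0; have [T tT] := finite_index_transversal (finite_N p).
rewrite -[y]mulr1 -(rel_III rels (finite_N p) tT) mulr_sumr.
by apply: big1 => t _; rewrite !mulrA -(mulrA y) y0 !mul0r.
Qed.

(** The average w over a transversal satisfies w u_g s_p = u_g x for every g: only the
    coset of g contributes, since s_p^* u_k s_p = 0 for k outside theta_p(G).
    This description no longer mentions the transversal and shows that w commutes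
    with each u_g, so that w lies in the commutant of D, which is D. *)
Lemma intertwiner_factor p x : (forall h, x * u h = u (theta p h) * x) ->
  exists2 w, D w & x = w * s p.
Proof.
move=> xu; have U := rel_unitary rels.
have [T tT] := finite_index_transversal (finite_N p).
pose w := \sum_(t <- T) u t * x * star (s p) * star (u t).
have wE g : w * (u g * s p) = u g * x.
  have [uT /(_ g) [t [[Tt tg] t_uniq]]] := tT.
  have [h gE] := (theta_coset p t g).1 tg.
  rewrite mulr_suml (bigD1_seq t) //= big1_seq ?addr0.
    rewrite star_u -!mulrA [u _ * (u _ * _)]mulrA -(urep_mul U) gE mulKg.
    by rewrite [star _ * _]mulrA covariance_star xu mulrA -(urep_mul U).
  move=> t' /andP [tt' Tt'].
  rewrite star_u -!mulrA [u _ * (u _ * _)]mulrA -(urep_mul U).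
  rewrite [star _ * _]mulrA corner_zero ?mulr0 // => -[h' hE].
  move/eqP: tt'; apply; apply/esym/t_uniq; split=> //.
  by apply/theta_coset; exists h'; rewrite -hE mulVKg.
exists w; last by rewrite -[s p]mul1r -(urep_one U) wE (urep_one U) mul1r.
apply: (masa_commutant masa); apply: commutant_generated range_u_star _ _.
move=> _ [g _ <-]; apply/eqP; rewrite -subr_eq0; apply/eqP.
apply: (@separate_by_ranges p) => k.
rewrite mulrBl -!mulrA wE [u g * (u k * s p)]mulrA -(urep_mul U) wE.
by rewrite (urep_mul U) mulrA subrr.
Qed.

Lemma aut_fixing_factor (f : star_aut A) p : aut_fixing D f ->
  exists2 w, D w & sval f (s p) = w * s p.
Proof.
move=> fixf; have hf : is_star_hom (sval f) by case: (svalP f).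
apply: intertwiner_factor => h.
rewrite -{1}(fixf _ (u_in_D h)) -star_homM // (rel_I rels) star_homM //.
by rewrite fixf //; exact: u_in_D.
Qed.

(** The uniqueness clause of the universal property, applied to the generators
    themselves, shows that g^-1 f is the identity. *)
Lemma star_aut_eq (f g : star_aut A) :
  (forall h, sval f (u h) = sval g (u h)) ->
  (forall p, sval f (s p) = sval g (s p)) -> f = g.
Proof.
move=> fu fs; suff e : (g^-1 * f = 1)%g by rewrite -[f](mulVKg g) e mulg1.
have [_ _ /(_ A u s rels) [f0 [_ f0_uniq]]] := bq.
apply: star_aut_inj => x.
have f0_id : f0 = idfun.
  by apply: f0_uniq; split=> //; case: (star_aut_id_subproof A).
rewrite /= -[RHS]/(idfun x) -f0_id (f0_uniq (sval (g^-1 * f)%g)) //; split.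
- by case: (svalP (g^-1 * f)%g).
- by move=> h; rewrite star_aut_mulE fu star_aut_VK.
- by move=> p; rewrite star_aut_mulE fs star_aut_VK.
Qed.

Lemma aut_fixing_abelian (f g : star_aut A) :
  aut_fixing D f -> aut_fixing D g -> (f * g = g * f)%g.
Proof.
move=> fixf fixg; apply: star_aut_eq => [h|p]; rewrite !star_aut_mulE.
  by rewrite !(fixf, fixg) //; exact: u_in_D.
have hf : is_star_hom (sval f) by case: (svalP f).
have hg : is_star_hom (sval g) by case: (svalP g).
have [w Dw fE] := aut_fixing_factor p fixf.
have [v Dv gE] := aut_fixing_factor p fixg.
rewrite gE fE !star_homM // fixf // fixg // gE fE !mulrA; congr (_ * _).
by case: masa => _ + _; apply.
Qed.

End BoundaryQuotientAutomorphisms.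

Theorem theorem6p5 (R : realType) (G : groupType) (P : monoidType)
    (theta : P -> G -> G) (A : cstarAlgType R) (u : G -> A) (s : P -> A)
    (ads : algebraic_dynamical_system theta)
    (abelian_G : forall g h : G, (g * h = h * g)%g)
    (abelian_P : forall p q : P, (p * q = q * p)%g)
    (finite_N : forall p : P, finite_index (range (theta p)))
    (bq : is_boundary_quotient theta u s)
    (masa : maximal_abelian_subalgebra (cstar_generated (range u)))
    (simple_A : cstar_simple A) :
  maximal_abelian_subgroup (aut_fixing (cstar_generated (range u))).
Proof.
case: ads => _ _ action _; apply: masa_maximal_abelian_aut => // f g.
exact: (aut_fixing_abelian action finite_N bq masa).
Qed.
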